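(* A function $f:\mathbb{R}\to\mathbb{R}$ is continuous if and only if $f$ has closed graph and is returning.
   Context: A function $f:X\to Y$ between topological spaces has closed graph if its graph $\Gamma_f=\{\langle x,f(x)\rangle : x\in X\}$ is a closed subset of the product $X\times Y$. A real-valued function $f:X\to\mathbb{R}$ on a topological space $X$ is returning at a point $x\in X$ if there exists a positive real number $M_x$ such that for every path-connected subset $C_x\subset X$ containing the point $x$ and any $y\in C_x\setminus\{x\}$ there exists a point $z\in C_x\setminus\{x,y\}$ such that $|f(z)|\le\max\{M_x,|f(y)|\}$. The function $f$ is returning if it is returning at each point $x\in X$. Here these notions are applied with $X=Y=\mathbb{R}$ carrying the usual topology. *)

(* Defs.v *)
From mathcomp Require Export all_boot all_order all_algebra.
From mathcomp Require Export all_classical all_reals all_analysis.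
Export Order.TTheory GRing.Theory Num.Theory.
Export numFieldNormedType.Exports.

Set Implicit Arguments.
Unset Strict Implicit.
Unset Printing Implicit Defensive.

Local Open Scope classical_set_scope.
Local Open Scope ring_scope.

Definition closed_graph (X Y : topologicalType) (f : X -> Y) : Prop :=
  closed [set (x, f x) | x in [set: X]].

(* A path is a total function on [R], of which only the restriction to [[0, 1]]
   matters; the empty set is path-connected under this definition. *)
Definition path_connected (R : realType) (X : topologicalType) (C : set X) :
    Prop :=
  forall a b : X, C a -> C b ->
  exists g : R -> X,
    [/\ {within `[0, 1], continuous g}, g 0 = a, g 1 = b
      & g @` `[0, 1] `<=` C].

Definition returning_at (R : realType) (X : topologicalType) (f : X -> R)
    (x : X) : Prop :=
  exists2 M : R, 0 < M &
    forall C : set X, path_connected R C -> C x ->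
    forall y, (C `\ x) y ->
    exists2 z, (C `\` [set x; y]) z & `|f z| <= Num.max M `|f y|.

Definition returning (R : realType) (X : topologicalType) (f : X -> R) : Prop :=
  forall x : X, returning_at f x.

(* Main.v *)
Require Import Defs.
From mathcomp Require Import lra.

Set Implicit Arguments.
Unset Strict Implicit.
Unset Printing Implicit Defensive.

Local Open Scope classical_set_scope.
Local Open Scope ring_scope.

(** Continuity of a function with closed graph is the same as local boundedness,
    since preimages of compact sets are closed.  Hence the task is to show that
    the closed set [D] of points where [f] is not locally bounded is empty.

    The returning condition, used on segments only, gives at each [x] a bound
    [M] such that every [y <> x] leads to a point strictly between [x] and [y]
    at which [|f|] is at most [max M |f y|].  Iterating this on the closed set
    where [|f| <= max M |f y|], whose points on the right of [x] must then
    accumulate at [x], one finds points [z] tending to [x] from the right with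
    [f z] bounded, and so with [f z] tending to [f x] because the graph is
    closed ([between_right_approachable]); the left side is obtained by
    reflecting the line.

    Suppose now that [D] is not empty.  A Baire argument gives a ball, centred
    at some [c] in [D], such that [|f| <= n] on the part of [D] in that ball
    ([baire_bounded]).  Off [D] the function is continuous.  If
    [|f y| > n + 1] for some [y > c] near [c], let [a] be the last point of [D]
    before [y].  Then [|f a| <= n], and [|f|] is less than [n + 1] somewhere
    between [a] and [y], so the intermediate value theorem on this gap gives a
    point, still between [c] and [y], where [|f| = n + 1].  As the level set
    [|f| = n + 1] is closed and misses [c], this cannot occur close to [c]
    ([right_bounded]).  So [f] is bounded on both sides of [c], which
    contradicts [c] in [D].

    Conversely, a continuous function satisfies the returning condition with
    [M = |f x| + 1]: a path-connected subset of the line that contains [x] and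
    [y] also contains the points between them that are close to [x]. *)

(** * Closed graphs in topological spaces *)

Lemma continuous_closed_graph (X Y : topologicalType) (f : X -> Y) :
  hausdorff_space Y -> continuous f -> closed_graph f.
Proof.
rewrite open_hausdorff => hY cf; rewrite /closed_graph closedE => -[x y] /= H.
exists x => //; congr pair; apply: contrapT => /eqP fxy; apply: H.
have [[A B] /= [fxA yB] [oA oB AB0]] := hY _ _ fxy.
have nA : \forall x' \near x, A (f x').
  by apply: cf; apply: open_nbhs_nbhs; split => //; exact: set_mem.
have nB : \forall y' \near y, B y'.
  by apply: open_nbhs_nbhs; split => //; exact: set_mem.
exists ([set x' | A (f x')], B) => // -[u v] /= [Au Bv] [t _ [tu tv]].
have : (A `&` B) v by split; rewrite // -tv tu.
by rewrite (eqP AB0).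
Qed.

(** If [f x] is outside [K], no point of [{x} * K] is in the graph; by
    compactness a whole tube around [{x} * K] avoids the graph. *)
Lemma closed_graph_preimage_compact (X Y : topologicalType) (f : X -> Y)
    (K : set Y) :
  closed_graph f -> compact K -> closed (f @^-1` K).
Proof.
move=> cf /compact_near_coveringP cK; rewrite closedE => x /= H.
apply: contrapT => nKfx; apply: H.
suff : \forall x' \near x, K `<=` [set y | y <> f x'].
  by apply: filterS => x' h Kfx'; exact: h Kfx' _.
apply: cK => y Ky.
have : ~ [set (u, f u) | u in [set: X]] (x, y).
  by case=> u _ [ux uy]; apply: nKfx; rewrite -ux uy.
move=> nG; have : nbhs (x, y) (~` [set (u, f u) | u in [set: X]]).
  by apply: open_nbhs_nbhs; split => //; exact: closed_openC.
case=> -[A B] /= [xA yB] AB; exists (B, A) => // -[v u] /= [Bv Au] vfu.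
by apply: (AB (u, v)) => //; exists u => //; rewrite vfu.
Qed.

Definition bounded_at (R : realType) (f : R -> R) (x : R) : Prop :=
  exists M : R, \forall y \near x, `|f y| <= M.

Lemma itvccNE (R : realType) (M t : R) :
  (t \in `[- M, M]) = (`|t| <= M).
Proof. by rewrite in_itv /= ler_norml. Qed.

(** Some points to the right of [x] converge to [x] with values converging to
    [f x]: the right half of Young's condition. *)
Definition right_approachable (R : realType) (f : R -> R) (x : R) : Prop :=
  forall d e : R, 0 < d -> 0 < e ->
    exists2 z, x < z < x + d & `|f x - f z| < e.

Lemma open_bounded_at (R : realType) (f : R -> R) :
  open [set x | bounded_at f x].
Proof.
rewrite openE => x [M nM]; move/near_join: nM.
by apply: filterS => y nM; exists M.
Qed.

(** * Real functions with closed graph *)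

Section ClosedGraph.
Context (R : realType) (f : R -> R).
Hypothesis cf : closed_graph f.

(** The set of values in [[-M, M]] at distance at least [e] from [f x] is
    compact and misses [f x], so its preimage is closed and misses [x]. *)
Lemma closed_graph_near_dist (x M e : R) : 0 < e ->
  \forall y \near x, `|f y| <= M -> `|f x - f y| < e.
Proof.
move=> e0; pose K := `[- M, M]%classic `&` ~` ball (f x) e.
have cK : compact K.
  apply: compact_closedI; first exact: segment_compact.
  exact/open_closedC/ball_open.
have : nbhs x (~` (f @^-1` K)).
  apply: open_nbhs_nbhs; split.
    exact: closed_openC (closed_graph_preimage_compact cf cK).
  by move=> [_]; apply; exact: ballxx.
apply: filterS => y nKy fy; apply: contrapT => nfy; apply: nKy; split => //.
by rewrite /= itvccNE.
Qed.

Lemma closed_graph_bounded_continuous (x : R) :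
  bounded_at f x -> {for x, continuous f}.
Proof.
case=> M nM; apply/cvgrPdist_lt => e e0.
by apply: filterS2 (closed_graph_near_dist x M e0) nM => y; apply.
Qed.

Lemma closed_graph_sublevel (c : R) : closed [set x | `|f x| <= c].
Proof.
rewrite (_ : [set _ | _] = f @^-1` `[- c, c]).
  by apply: closed_graph_preimage_compact => //; exact: segment_compact.
by apply/seteqP; split => x /=; rewrite itvccNE.
Qed.

Lemma closed_graph_level (c : R) : closed [set x | `|f x| = c].
Proof.
rewrite (_ : [set _ | _] = f @^-1` (`[- c, c] `&` [set t | c <= `|t|])).
  apply: closed_graph_preimage_compact => //; apply: compact_closedI.
    exact: segment_compact.
  apply: (@preimage_closed _ _ (fun t : R => `|t|) [set t | c <= t]).
    by move=> t _; exact: norm_continuous.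
  exact: closed_ge.
apply/seteqP; split => x /=.
  by move=> fx; split; rewrite /= ?itvccNE fx.
by rewrite itvccNE => -[? ?]; apply/eqP; rewrite eq_le; apply/andP.
Qed.

(** Otherwise one builds nested segments, the [n]-th of them centred in [D],
    with [|f| > n] on the next one (the sublevel sets of [|f|] are closed, so
    strict lower bounds persist nearby), and [|f|] exceeds every integer at a
    common point of all the segments.  This point need not be in [D], so [D] is
    arbitrary. *)
Lemma baire_bounded (D : set R) : D !=set0 ->
  exists (n : nat) (c r : R), [/\ 0 < r, D c &
    forall y, D y -> `|c - y| < r -> `|f y| <= n%:R].
Proof.
move=> [d Dd]; apply: contrapT => unb.
(* A pair [(c, r)] stands for the segment of centre [c] and radius [r]. *)
have step (s : nat * (R * R)) : exists s' : R * R,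
    D s.2.1 -> 0 < s.2.2 ->
    [/\ D s'.1, 0 < s'.2, s.2.1 - s.2.2 <= s'.1 - s'.2,
        s'.1 + s'.2 <= s.2.1 + s.2.2 &
        forall y, s'.1 - s'.2 <= y <= s'.1 + s'.2 -> s.1%:R < `|f y|].
  case: s => n [c r] /=.
  have [[Dc r0]|h] := pselect (D c /\ 0 < r); last first.
    by exists (c, r) => Dc r0; case: h.
  have [y [Dy cy fy]] : exists y, [/\ D y, `|c - y| < r & n%:R < `|f y|].
    apply: contrapT => h; apply: unb; exists n, c, r; split => // y Dy cy.
    by rewrite leNgt; apply/negP => fy; apply: h; exists y.
  have : nbhs y (~` [set x | `|f x| <= n%:R]).
    apply: open_nbhs_nbhs; split.
      exact: closed_openC (closed_graph_sublevel (c := _)).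
    by apply/negP; rewrite -ltNge.
  move=> /nbhs_ballP[/= e e0 ye].
  (* Half of each margin, so that the closed segment fits in both balls. *)
  pose r' := Num.min (e / 2) ((r - `|c - y|) / 2).
  have r'0 : 0 < r' by rewrite lt_min; apply/andP; split; lra.
  have r'e : r' <= e / 2 by rewrite ge_min lexx.
  have r'r : r' <= (r - `|c - y|) / 2 by rewrite ge_min lexx orbT.
  have [h1 h2] : c - y <= `|c - y| /\ - (c - y) <= `|c - y|.
    by rewrite ler_norm -normrN ler_norm.
  exists (y, r') => _ _ /=; split => //; [lra|lra|].
  move=> z /andP[z1 z2]; rewrite ltNge; apply/negP; apply: ye.
  rewrite /ball /= ltr_norml; lra.
have [g gP] := choice step.
pose s := fix s n := if n is m.+1 then g (m, s m) else (d, 1).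
have sP n : D (s n).1 /\ 0 < (s n).2.
  by elim: n => [//|n [IH1 IH2]] /=; have [] := gP (n, s n) IH1 IH2.
have sS n := gP (n, s n) (sP n).1 (sP n).2.
pose a n := (s n).1 - (s n).2; pose b n := (s n).1 + (s n).2.
have aS m n : (m <= n)%N -> a m <= a n.
  move=> /subnK <-; elim: (n - m)%N => [//|k IH].
  by apply: (le_trans IH); have [] := sS (k + m)%N.
have bS m n : (m <= n)%N -> b n <= b m.
  move=> /subnK <-; elim: (n - m)%N => [//|k IH].
  by apply: le_trans IH; have [] := sS (k + m)%N.
have ab m n : a m <= b n.
  have := aS _ _ (leq_maxl m n); have := bS _ _ (leq_maxr m n).
  by have [_] := sP (maxn m n); rewrite /a /b; lra.
pose p := sup (range a).
have ap n : a n <= p.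
  by apply: ub_le_sup; [exists (b 0%N) => _ [m _ <-]|exists n].
have pb n : p <= b n.
  by apply: ge_sup; [exists (a 0%N); exists 0%N|move=> _ [m _ <-]].
have fp n : n%:R < `|f p|.
  by have [_ _ _ _] := sS n; apply; rewrite (ap n.+1) (pb n.+1).
have := fp (Num.bound `|f p|).
by rewrite ltNge ltW // archi_boundP.
Qed.

(** Call bad the points where [f] is not locally bounded.  The last bad point
    before [y > x] lies in [[x, y)], so [|f| <= n] there; a value of [|f|] above
    [n + 1] at [y] would then force, by continuity after that bad point, a point
    between [x] and [y] where [|f|] is exactly [n + 1].  Such points stay away
    from [x]. *)
Lemma right_bounded (n : nat) (x d : R) :
    (forall x, right_approachable f x) ->
    0 < d -> ~ bounded_at f x ->
    (forall y, `|x - y| < d -> ~ bounded_at f y -> `|f y| <= n%:R) ->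
  exists2 d', 0 < d' & forall y, x < y < x + d' -> `|f y| <= n.+1%:R.
Proof.
move=> ra d0 Dx Dn.
have fxn : `|f x| <= n%:R by apply: Dn; rewrite ?subrr ?normr0.
have nS : n.+1%:R = n%:R + 1 :> R by rewrite -natr1.
have : nbhs x (~` [set y | `|f y| = n.+1%:R]).
  apply: open_nbhs_nbhs; split; first by
    exact: closed_openC (closed_graph_level (c := _)).
  by move=> /= fx; move: fxn; rewrite fx nS; lra.
move=> /nbhs_ballP[/= e e0 xe].
exists (Num.min d e) => [|y /andP[xy yd]]; first by rewrite lt_min d0.
have yd1 : y < x + d by apply: (lt_le_trans yd); rewrite lerD2l ge_min lexx.
have ye : y < x + e.
  by apply: (lt_le_trans yd); rewrite lerD2l ge_min lexx orbT.
rewrite leNgt; apply/negP => fy.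
pose S := [set u | ~ bounded_at f u /\ u <= y].
have S0 : S !=set0 by exists x; split => //; exact: ltW.
have Sy : ubound S y by move=> u [].
pose a := sup S.
have xa : x <= a by apply: ub_le_sup; [exists y|split => //; exact: ltW].
have ay : a <= y by exact: ge_sup.
have cS : closed S.
  apply: closedI; last exact: closed_le.
  exact: open_closedC (@open_bounded_at R f).
have [Da _] : S a by apply: cS; apply: closure_sup => //; exists y.
have near_x u : x <= u -> u <= y -> `|x - u| < d /\ `|x - u| < e.
  by move=> xu uy; rewrite !ltr_norml; split; lra.
have fa : `|f a| <= n%:R by apply: Dn => //; exact: (near_x _ xa ay).1.
have {}ay : a < y.
  rewrite lt_neqAle ay andbT; apply/eqP => ay'.
  by move: fa; rewrite ay'; move: fy; rewrite nS; lra.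
have [z /andP[az zy] fz] : exists2 z, a < z < a + (y - a) & `|f a - f z| < 1.
  by apply: ra; lra.
have {}zy : z < y by lra.
have {}fz : `|f z| < n.+1%:R.
  have := lerB_dist (f z) (f a); rewrite distrC nS; lra.
have cfz : {within `[z, y], continuous (fun t => `|f t|)}.
  apply: continuous_in_subspaceT => t; rewrite inE /= in_itv /= => /andP[zt ty].
  apply: continuous_comp; last exact: norm_continuous.
  apply: closed_graph_bounded_continuous; apply: contrapT => Dt.
  have : t <= a by apply: ub_le_sup; [exists y|].
  lra.
have [|w] := IVT (ltW zy) cfz (v := n.+1%:R).
  by rewrite ge_min le_max (ltW fz) (ltW fy) /= orbT.
rewrite in_itv /= => /andP[zw wy]; apply: xe.
by apply: (near_x _ _ _).2 => //; lra.
Qed.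

End ClosedGraph.

(** * Consequences of the returning condition *)

(** The returning condition restricted to segments.  Points between [x] and [y]
    are written with a barycentric parameter so that the condition is symmetric
    under a reflection of the line. *)
Definition between_returning (R : realType) (f : R -> R) : Prop :=
  forall x, exists M : R, forall y, y <> x ->
    exists2 t, 0 < t < 1 & `|f (x + t * (y - x))| <= Num.max M `|f y|.

(** Segments are path-connected. *)
Lemma returning_between (R : realType) (f : R -> R) :
  returning f -> between_returning f.
Proof.
move=> rf x; have [M _ Mf] := rf x; exists M => y yx.
pose C := [set x + t * (y - x) | t in `[0, 1]].
have pC : path_connected R C.
  move=> _ _ [s s01 <-] [u u01 <-].
  exists (fun t => x + (s + t * (u - s)) * (y - x)); split.
  - apply: continuous_subspaceT => t.
    apply: cvgD; first exact: cvg_cst.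
    apply: cvgMr_tmp; apply: cvgD; first exact: cvg_cst.
    by apply: cvgMr_tmp; exact: cvg_id.
  - by rewrite mul0r addr0.
  - by rewrite mul1r subrKC.
  - move=> _ [t t01 <-]; exists (s + t * (u - s)) => //.
    move: s01 u01 t01; rewrite /= !in_itv /= => /andP[? ?] /andP[? ?] /andP[? ?].
    by apply/andP; split; nra.
have Cx : C x by exists 0; rewrite ?mul0r ?addr0 //= in_itv /= lexx ler01.
have Cy : C y.
  by exists 1; rewrite ?mul1r /= ?in_itv /= ?lexx ?ler01 // subrKC.
have [|z [[t t01 <-] nxy] fz] := Mf C pC Cx y; first by split.
exists t => //; move: t01; rewrite /= in_itv /= => /andP[t0 t1].
rewrite !lt_neqAle t0 t1 !andbT; apply/andP; split; apply/eqP => t'.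
  by apply: nxy; left; rewrite -t' mul0r addr0.
by apply: nxy; right; rewrite /= t' mul1r subrKC.
Qed.

(** The points [z] right of [x] with [|f z| <= N] form a set without least
    element, because the returning condition always supplies a smaller one.
    Sublevel sets being closed, the infimum can only be [x]. *)
Lemma between_right_approachable (R : realType) (f : R -> R) :
  closed_graph f -> between_returning f -> forall x, right_approachable f x.
Proof.
move=> cf bf x d e d0 e0; have [M Mf] := bf x.
pose N := Num.max M `|f (x + d)|.
pose S := [set z | x < z <= x + d /\ `|f z| <= N].
have low z : S z -> exists2 z', S z' & z' < z.
  move=> [/andP[xz zd] fz]; have [|t /andP[t0 t1] ft] := Mf z.
    by apply/eqP; rewrite gt_eqF.
  exists (x + t * (z - x)); last by nra.
  split; first by apply/andP; split; nra.
  by apply: (le_trans ft); rewrite ge_max fz le_max lexx.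
have Sd : S (x + d) by split; [rewrite lexx andbT; lra|rewrite le_max lexx orbT].
have Sx : lbound S x by move=> z [/andP[/ltW]].
have iS : has_inf S by split; [exists (x + d)|exists x].
have xS : inf S = x.
  apply/eqP; rewrite eq_le; apply/andP; split; last first.
    by apply: lb_le_inf => //; exists (x + d).
  rewrite leNgt; apply/negP => xi.
  have : S (inf S).
    split.
      by rewrite xi /=; exact: ge_inf iS.2 _ Sd.
    apply: closed_graph_sublevel => //.
    move=> B /nbhs_ballP[/= r r0 rB].
    have [z Sz zr] := inf_adherent r0 iS.
    exists z; split; first by case: Sz.
    apply: rB; rewrite /ball /= ltr_norml.
    by have := ge_inf iS.2 Sz; lra.
  by move=> /low[z /(ge_inf iS.2)]; lra.
have /nbhs_ballP[/= r r0 xr] := closed_graph_near_dist cf x N e0.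
have [z Sz] := inf_adherent r0 iS.
rewrite xS => zr; have [z' [/andP[xz' zd'] fz'] zz'] := low z Sz.
exists z'; last by apply: xr; rewrite // /ball /= ltr_norml; lra.
case: Sz => /andP[_ zd] _.
by rewrite xz' /=; lra.
Qed.

(** * Reflection and conclusion *)

Lemma between_returningN (R : realType) (f : R -> R) :
  between_returning f -> between_returning (f \o -%R).
Proof.
move=> bf x; have [M Mf] := bf (- x); exists M => y yx.
have [|t t01 ft] := Mf (- y); first by move/oppr_inj.
by exists t => //=; rewrite opprD -mulrN opprD.
Qed.

Lemma closed_graphN (R : realType) (f : R -> R) :
  closed_graph f -> closed_graph (f \o -%R).
Proof.
move=> cf; pose h (p : R * R) := (- p.1, p.2).
have ch : continuous h.
  move=> p; apply: (@cvg_pair _ _ _ (nbhs p) (nbhs (- p.1)) (nbhs p.2)).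
    by apply: cvgN; exact: cvg_fst.
  exact: cvg_snd.
rewrite /closed_graph.
rewrite (_ : [set _ | _ in _] = h @^-1` [set (x, f x) | x in [set: R]]).
  by apply: (preimage_closed _ cf) => p _; exact: ch.
apply/seteqP; split => [_ [x _ <-]|[x y] [z _ [zx zy]]] /=.
  by exists (- x).
by exists x => //=; rewrite -zx zy.
Qed.

Lemma bounded_atN (R : realType) (f : R -> R) (x : R) :
  bounded_at (f \o -%R) x <-> bounded_at f (- x).
Proof.
split=> -[M nM]; exists M; first exact/nearN.
exact: (iffLR (nearN _ (fun y => `|f y| <= M))).
Qed.

Lemma closed_graph_between_bounded (R : realType) (f : R -> R) (x : R) :
  closed_graph f -> between_returning f -> bounded_at f x.
Proof.
move=> cf bf; apply: contrapT => Dx0.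
have [|n [c [r [r0 Dc Dn]]]] := baire_bounded cf (D := ~` bounded_at f).
  by exists x.
have [d1 d10 f1] := right_bounded cf (between_right_approachable cf bf) r0 Dc
  (fun y cy Dy => Dn y Dy cy).
have [|y cy Dy|d2 d20 f2] := right_bounded (n := n) (closed_graphN cf)
    (between_right_approachable (closed_graphN cf) (between_returningN bf))
    (x := - c) r0.
- by move/bounded_atN; rewrite opprK.
- apply: Dn => [fy|]; first by apply: Dy; apply/bounded_atN.
  rewrite -normrN; apply: le_lt_trans cy.
  by rewrite opprB addrC.
apply: Dc; exists (Num.max n.+1%:R `|f c|).
apply/nbhs_ballP; exists (Num.min d1 d2) => /=; first by rewrite lt_min d10.
move=> y; rewrite /ball /= lt_min !ltr_norml => /andP[h1 h2].
have [cy|yc|<-] := ltgtP c y; last by rewrite le_max lexx orbT.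
  by rewrite le_max f1 //; lra.
by rewrite le_max -(opprK y) [`|f _|]/(`|(f \o -%R) _|) f2 //; lra.
Qed.

(** A path from [x] to [y] inside the path-connected set meets every point
    between [x] and [y], in particular those near [x], where
    [|f| <= |f x| + 1]. *)
Lemma continuous_returning (R : realType) (f : R -> R) :
  continuous f -> returning f.
Proof.
move=> cf x; exists (`|f x| + 1); first by rewrite ltr_wpDl.
move=> C pC Cx y [Cy /= yx].
have [g [cg g0 g1 gC]] := pC _ _ Cx Cy.
have [r r0 xr] : exists2 r : R, 0 < r &
    forall z, `|x - z| < r -> `|f z| <= `|f x| + 1.
  have /cvgrPdist_lt/(_ _ ltr01)/nbhs_ballP[/= r r0 xr] := cf x.
  exists r => // z /xr /= fz; rewrite -lerBlDl.
  by apply: (le_trans (lerB_dist _ _)); rewrite distrC ltW.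
have [z zb xz] : exists2 z, (x < z < y) || (y < z < x) & `|x - z| < r.
  pose m := Num.min (r / 2) (`|y - x| / 2).
  have m0 : 0 < m by rewrite lt_min !divr_gt0 // normr_gt0 subr_eq0; apply/eqP.
  have mr : m <= r / 2 by rewrite ge_min lexx.
  have my : m <= `|y - x| / 2 by rewrite ge_min lexx orbT.
  have [xy|xy|/esym//] := ltgtP x y.
    move: my; rewrite gtr0_norm ?subr_gt0// => my.
    by exists (x + m); [|rewrite ltr_norml]; lra.
  move: my; rewrite ltr0_norm ?subr_lt0// => my.
  by exists (x - m); [|rewrite ltr_norml]; lra.
exists z; last by rewrite le_max xr.
split; last by case=> /= zE; move: zb; rewrite zE !ltxx ?andbF.
have [|t t01 <-] := IVT ler01 cg (v := z).
  by rewrite g0 g1 ge_min le_max; lra.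
by apply: gC; exists t.
Qed.

Theorem theorem1 (R : realType) (f : R -> R) :
  continuous f <-> closed_graph f /\ returning f.
Proof.
split=> [cf|[cf rf] x].
  split; last exact: continuous_returning.
  by apply: continuous_closed_graph => //; exact: Rhausdorff.
apply: closed_graph_bounded_continuous => //.
exact: closed_graph_between_bounded (returning_between rf).
Qed.
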